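(* Let $\mathcal{U}\in \mathbb{C}^{I_1\times\cdots\times I_M \times J_1\times\cdots\times J_N }$, $\mathcal{V}\in \mathbb{C}^{J_1\times\cdots\times J_N \times K_1\times\cdots\times K_L }$ and $\mathcal{W}\in \mathbb{C}^{K_1\times\cdots\times K_L \times H_1\times\cdots\times H_R }$, let $\mathcal{A} = \mathcal{U}*_N\mathcal{V}*_L\mathcal{W}$, and let $\mathcal{M} \in \mathbb{C}^{I_1\times\cdots\times I_M \times I_1 \times\cdots\times I_M}$ and $\mathcal{N} \in \mathbb{C}^{H_1\times\cdots\times H_R \times H_1 \times\cdots\times H_R}$ be Hermitian positive definite tensors. Then: (a) $\mathcal{A}^\dagger_{\mathcal{M},\mathcal{N}} = \mathcal{X}^\dagger_{\mathcal{I}_N,\mathcal{N}}*_N\mathcal{V}*_L \mathcal{Y}^\dagger_{\mathcal{M},\mathcal{I}_L}$, where $\mathcal{X} = (\mathcal{U}*_N\mathcal{V}*_L\mathcal{V}^\dagger)^\dagger*_M\mathcal{A}$ and $\mathcal{Y} = \mathcal{A}*_R(\mathcal{V}^\dagger*_N\mathcal{V}*_L\mathcal{W})^\dagger$; (b) $\mathcal{A}^\dagger_{\mathcal{M},\mathcal{N}} = \mathcal{X}^\dagger_{\mathcal{I}_L,\mathcal{N}}*_L\mathcal{V}^**_N\mathcal{V} *_L \mathcal{V}^**_N \mathcal{Y}^\dagger_{\mathcal{M},\mathcal{I}_N}$, where $\mathcal{X} = [\mathcal{U}*_N(\mathcal{V}^\dagger)^*]^\dagger*_M\mathcal{A}$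 and $\mathcal{Y} = \mathcal{A}*_R[(\mathcal{V}^\dagger)^**_L\mathcal{W}]^\dagger$.
   Context: Einstein product: for $\mathcal{A}\in\mathbb{C}^{I_1\times\cdots\times I_M\times J_1\times\cdots\times J_N}$ and $\mathcal{B}\in\mathbb{C}^{J_1\times\cdots\times J_N\times K_1\times\cdots\times K_L}$, $(\mathcal{A}*_N\mathcal{B})_{i_1\ldots i_Mk_1\ldots k_L}=\sum_{j_1,\ldots,j_N}a_{i_1\ldots i_Mj_1\ldots j_N}b_{j_1\ldots j_Nk_1\ldots k_L}$ (the subscript is the number of contracted indices; similarly $*_M,*_L,*_R$). The conjugate transpose $\mathcal{A}^*$ has entries $(\mathcal{A}^* )_{j_1\ldots j_Ni_1\ldots i_M}=\overline{a_{i_1\ldots i_Mj_1\ldots j_N}}$. $\mathcal{I}_N$ and $\mathcal{I}_L$ are the identity tensors of $\mathbb{C}^{J_1\times\cdots\times J_N\times J_1\times\cdots\times J_N}$ and $\mathbb{C}^{K_1\times\cdots\times K_L\times K_1\times\cdots\times K_L}$ (entries: products of Kronecker deltas). A tensor $\mathcal{P}$ with the same row and column index sets is Hermitian positive definite if $\mathcal{P}=\mathcal{Z}*\mathcal{D}*\mathcal{Z}^*$ (Einstein products over all the row indices) with $\mathcal{Z}$ unitary ($\mathcal{Z}*\mathcal{Z}^*=\mathcal{Z}^**\mathcal{Z}$ is the identity tensor) and $\mathcal{D}$ a diagonal tensor with positive diagonal entries. Weighted Moore-Penrose inverse: for $\mathcal{A}\in\mathbb{C}^{I_1\times\cdots\times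 I_M\times J_1\times\cdots\times J_N}$ and Hermitian positive definite $\mathcal{M}\in\mathbb{C}^{I_1\times\cdots\times I_M\times I_1\times\cdots\times I_M}$, $\mathcal{N}\in\mathbb{C}^{J_1\times\cdots\times J_N\times J_1\times\cdots\times J_N}$, $\mathcal{A}^\dagger_{\mathcal{M},\mathcal{N}}$ is the unique $\mathcal{Y}\in\mathbb{C}^{J_1\times\cdots\times J_N\times I_1\times\cdots\times I_M}$ with $\mathcal{A}*_N\mathcal{Y}*_M\mathcal{A}=\mathcal{A}$, $\mathcal{Y}*_M\mathcal{A}*_N\mathcal{Y}=\mathcal{Y}$, $(\mathcal{M}*_M\mathcal{A}*_N\mathcal{Y})^*=\mathcal{M}*_M\mathcal{A}*_N\mathcal{Y}$, $(\mathcal{N}*_N\mathcal{Y}*_M\mathcal{A})^*=\mathcal{N}*_N\mathcal{Y}*_M\mathcal{A}$; the same definition applies with other index sets. The Moore-Penrose inverse $\mathcal{A}^\dagger$ is the case where both weights are identity tensors. *)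

(* Defs.v *)
From mathcomp Require Import all_boot all_order all_algebra.
From mathcomp Require Import boolp classical_sets reals.
From mathcomp Require Export complex.

Set Implicit Arguments.
Unset Strict Implicit.
Unset Printing Implicit Defensive.

Import Order.TTheory GRing.Theory Num.Theory.
Local Open Scope ring_scope.

(* Multi-indices (i_1, ..., i_M), 0-based, for the dimensions I_1, ..., I_M
   given by I : 'I_M -> nat. *)
Notation midx I := {dffun forall k, 'I_(I k)}.

(* Tensors in C^{I_1 x ... x I_M x J_1 x ... x J_N}, where C = R[i] with R the
   real numbers; the indices are split into a row and a column multi-index. *)
Definition tensor (R : realType) (M N : nat)
    (I : 'I_M -> nat) (J : 'I_N -> nat) :=
  {ffun midx I * midx J -> R[i]}.

Definition einstein (R : realType) (M N L : nat)
    (I : 'I_M -> nat) (J : 'I_N -> nat) (K : 'I_L -> nat)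
    (A : tensor R I J) (B : tensor R J K) : tensor R I K :=
  [ffun ik => \sum_(j : midx J) A (ik.1, j) * B (j, ik.2)].

Notation "A *e B" := (einstein A B) (at level 40, left associativity).

Definition ctrans (R : realType) (M N : nat)
    (I : 'I_M -> nat) (J : 'I_N -> nat) (A : tensor R I J) : tensor R J I :=
  [ffun ji => Num.conj (A (ji.2, ji.1))].

Definition idt (R : realType) (N : nat) (J : 'I_N -> nat) : tensor R J J :=
  [ffun ij : midx J * midx J => \prod_(k < N) (ij.1 k == ij.2 k)%:R].

Definition unitary (R : realType) (N : nat) (J : 'I_N -> nat)
    (Z : tensor R J J) : Prop :=
  Z *e ctrans Z = idt R J /\ ctrans Z *e Z = idt R J.

Definition diagonal (R : realType) (N : nat) (J : 'I_N -> nat)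
    (D : tensor R J J) : Prop :=
  forall i j : midx J, i <> j -> D (i, j) = 0.

(* The order on R[i] is such that 0 < z means that z is real and positive. *)
Definition hermitian_posdef (R : realType) (N : nat) (J : 'I_N -> nat)
    (P : tensor R J J) : Prop :=
  exists Z D : tensor R J J,
    [/\ unitary Z, diagonal D, forall j : midx J, 0 < D (j, j)
      & P = Z *e D *e ctrans Z].

Definition is_wmpinv (R : realType) (M N : nat)
    (I : 'I_M -> nat) (J : 'I_N -> nat)
    (P : tensor R I I) (Q : tensor R J J)
    (A : tensor R I J) (Y : tensor R J I) : Prop :=
  [/\ A *e Y *e A = A,
      Y *e A *e Y = Y,
      ctrans (P *e A *e Y) = P *e A *e Y
    & ctrans (Q *e Y *e A) = Q *e Y *e A].

(* The solution Y of the four weighted Penrose equations, which exists and is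
   unique when the weights P and Q are Hermitian positive definite; the default
   value 0 of [xget] is only taken when there is no solution. *)
Definition wmpinv (R : realType) (M N : nat)
    (I : 'I_M -> nat) (J : 'I_N -> nat)
    (P : tensor R I I) (Q : tensor R J J) (A : tensor R I J) : tensor R J I :=
  xget ([ffun=> 0] : tensor R J I) [set Y | is_wmpinv P Q A Y]%classic.

Definition mpinv (R : realType) (M N : nat)
    (I : 'I_M -> nat) (J : 'I_N -> nat) (A : tensor R I J) : tensor R J I :=
  wmpinv (idt R I) (idt R J) A.

(* Main.v *)
(** Write [P = U^dag U] and [Q = W W^dag], and let [A = U B W], [X = U^dag A],
    [Y = A W^dag].  With [S] and [T] the weighted inverses of [X] and [Y], the
    products [E = X S] and [F = T Y] are Hermitian idempotents below [P] and [Q],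
    so [S B T = S E P B Q F T = S (P B Q) T], and [P B Q = X W^dag = U^dag Y].
    Hence [S B T A = S X] and [A S B T = Y T], which makes [S B T] the weighted
    inverse of [A].  Part (a) is [B = V] with [U V V^dag] and [V^dag V W] as outer
    factors; part (b) is [B = V* V V*] with [U (V^dag)*] and [(V^dag)* W]. *)

Require Import Defs.
From mathcomp Require Import all_boot all_order all_algebra reals.
From mathcomp Require Import classical_sets.

Set Implicit Arguments.
Unset Strict Implicit.
Unset Printing Implicit Defensive.

Import Order.TTheory GRing.Theory Num.Theory.
Local Open Scope ring_scope.
Local Open Scope sesquilinear_scope.

(** * Definite matrices and weighted inverses of matrices *)

Section MatrixInverse.
Context {C : numClosedFieldType}.

Lemma adjmxM m n p (A : 'M[C]_(m, n)) (B : 'M_(n, p)) :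
  (A *m B)^t* = B^t* *m A^t*.
Proof. by rewrite trmx_mul map_mxM. Qed.

Lemma adjmxV n (A : 'M[C]_n) : (invmx A)^t* = invmx (A^t*).
Proof. by rewrite trmx_inv map_invmx. Qed.

(** Anisotropy of the Hermitian form, whatever its sign: this is what makes Gram matrices
    invertible. *)
Definition definite n (P : 'M[C]_n) : Prop :=
  P^t* = P /\ forall v : 'rV_n, v *m P *m v^t* = 0 -> v = 0.

Lemma definite_unit n (P : 'M[C]_n) : definite P -> P \in unitmx.
Proof.
case=> _ defP; rewrite -row_free_unit; apply: inj_row_free => v vP0.
by apply: defP; rewrite vP0 mul0mx.
Qed.

(** The form of [invmx P] at [v] is the form of [P] at [v *m invmx P]. *)
Lemma definite_inv n (P : 'M[C]_n) : definite P -> definite (invmx P).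
Proof.
move=> dP; have uP := definite_unit dP; case: dP => herP defP.
have herV : (invmx P)^t* = invmx P by rewrite adjmxV herP.
split=> // v v0; have /defP w0 : v *m invmx P *m P *m (v *m invmx P)^t* = 0.
  by rewrite mulmxKV // adjmxM herV mulmxA.
by rewrite -(mulmxKV uP v) w0 mul0mx.
Qed.

(** If [v] is in the left kernel, then [v *m A] is isotropic for [P], hence zero, and [v] vanishes
    since the rows of [A] are free. *)
Lemma definite_gram r n (P : 'M[C]_n) (A : 'M_(r, n)) :
  definite P -> row_free A -> A *m P *m A^t* \in unitmx.
Proof.
move=> [_ defP] freeA; rewrite -row_free_unit; apply: inj_row_free => v v0.
have /defP /eqP : v *m A *m P *m (v *m A)^t* = 0.
  by rewrite adjmxM !mulmxA -[v *m A *m P]mulmxA -mulmxA mulmxA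
             -(mulmxA v) v0 mul0mx.
by rewrite mulmx_free_eq0 // => /eqP.
Qed.

Lemma row_free_adj m n (A : 'M[C]_(m, n)) : row_free (A^t*) = row_full A.
Proof. by rewrite row_free_map /row_free /row_full mxrank_tr. Qed.

(** The form is the sum of the nonnegative terms [|v_i|^2 D_ii], so each of them vanishes. *)
Lemma definite_diag n (D : 'M[C]_n) :
  (forall i j, i <> j -> D i j = 0) -> (forall i, 0 < D i i) ->
  forall v : 'rV_n, v *m D *m v^t* = 0 -> v = 0.
Proof.
move=> diagD posD v /matrixP/(_ 0 0); rewrite !mxE => sum0.
have termE i : (v *m D) 0 i * v^t* i 0 = `|v 0 i| ^+ 2 * D i i.
  rewrite !mxE (bigD1 i) //= big1 ?addr0; first by rewrite mulrAC normCK.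
  by move=> j /eqP ji; rewrite diagD ?mulr0.
apply/rowP => i; rewrite mxE; apply/eqP.
have nonneg j : true -> 0 <= (v *m D) 0 j * v^t* j 0.
  by rewrite termE mulr_ge0 ?exprn_ge0 // ltW.
have /(_ i isT) /eqP := psumr_eq0P nonneg sum0.
by rewrite termE mulf_eq0 expf_eq0 normr_eq0 /= (gt_eqF (posD i)) orbF.
Qed.

(* With [A = B R] a full-rank factorization, the weighted inverse is
   [Q^-1 R^t* (R Q^-1 R^t* )^-1 (B^t* P B)^-1 B^t* P]. *)
Lemma mx_wmpinv_exists m n (P : 'M[C]_m) (Q : 'M_n) (A : 'M_(m, n)) :
  definite P -> definite Q ->
  exists Y : 'M_(n, m),
    [/\ A *m Y *m A = A, Y *m A *m Y = Y,
        (P *m A *m Y)^t* = P *m A *m Y & (Q *m Y *m A)^t* = Q *m Y *m A].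
Proof.
move=> dP dQ; have uQ := definite_unit dQ; have dQV := definite_inv dQ.
have freeR := row_base_free A; have fullB := col_base_full A.
(* Generalizing the rank and both factors lets [A] be rewritten as [B *m R] without touching their
   types. *)
move: (\rank A) (col_base A) (row_base A) (mulmx_base A) fullB freeR.
move=> r B R defA fullB freeR.
have uG : R *m invmx Q *m R^t* \in unitmx.
  exact: definite_gram dQV freeR.
have uF : B^t* *m P *m B \in unitmx.
  rewrite -{2}(trmxCK B); apply: definite_gram dP _.
  by rewrite row_free_adj.
set G := R *m _ *m _ in uG; set F := B^t* *m _ *m _ in uF.
have herG : (invmx G)^t* = invmx G.
  by rewrite adjmxV /G !adjmxM trmxCK (proj1 dQV) mulmxA.
have herF : (invmx F)^t* = invmx F.
  by rewrite adjmxV /F !adjmxM trmxCK (proj1 dP) mulmxA.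
(* In [A *m Y] the factor [G] cancels, in [Y *m A] the factor [F]. This leaves [P B F^-1 B^t* P] for
   [P A Y] and [R^t* G^-1 R] for [Q Y A], both Hermitian by their shape. *)
pose Y := invmx Q *m R^t* *m invmx G *m invmx F *m B^t* *m P.
have AYE : A *m Y = B *m invmx F *m B^t* *m P.
  rewrite -defA /Y !mulmxA -(mulmxA B R) -(mulmxA B _ (R^t*)) -/G.
  by rewrite mulmxK.
have YAE : Y *m A = invmx Q *m R^t* *m invmx G *m R.
  rewrite -defA /Y !mulmxA -(mulmxA _ (B^t*) P) -(mulmxA _ _ B) -/F.
  by rewrite mulmxKV.
exists Y; split.
- rewrite AYE -[A in _ *m A]defA !mulmxA -(mulmxA _ (B^t*) P).
  by rewrite -(mulmxA _ _ B) -/F mulmxKV.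
- rewrite YAE /Y !mulmxA -(mulmxA _ R) -(mulmxA _ _ (R^t*)) -/G.
  by rewrite mulmxKV.
- by rewrite -mulmxA AYE !adjmxM trmxCK herF (proj1 dP) !mulmxA.
- rewrite -mulmxA YAE !mulmxA mulmxV // mul1mx.
  by rewrite !adjmxM trmxCK herG mulmxA.
Qed.

End MatrixInverse.

(** * Tensors as matrices over enumerated multi-indices *)

Section TensorMatrix.
Context {R : realType}.

Definition mx_of_tensor M N (I : 'I_M -> nat) (J : 'I_N -> nat)
    (A : tensor R I J) : 'M[R[i]]_(#|midx I|, #|midx J|) :=
  \matrix_(i, j) A (enum_val i, enum_val j).

Definition tensor_of_mx M N (I : 'I_M -> nat) (J : 'I_N -> nat)
    (A : 'M[R[i]]_(#|midx I|, #|midx J|)) : tensor R I J :=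
  [ffun ij => A (enum_rank ij.1) (enum_rank ij.2)].

Lemma mx_of_tensorK M N (I : 'I_M -> nat) (J : 'I_N -> nat) :
  cancel (@mx_of_tensor M N I J) (@tensor_of_mx M N I J).
Proof. by move=> A; apply/ffunP => -[i j]; rewrite ffunE mxE !enum_rankK. Qed.

Lemma tensor_of_mxK M N (I : 'I_M -> nat) (J : 'I_N -> nat) :
  cancel (@tensor_of_mx M N I J) (@mx_of_tensor M N I J).
Proof. by move=> A; apply/matrixP => i j; rewrite mxE ffunE !enum_valK. Qed.

Lemma mx_of_einstein M N L (I : 'I_M -> nat) (J : 'I_N -> nat)
    (K : 'I_L -> nat) (A : tensor R I J) (B : tensor R J K) :
  mx_of_tensor (A *e B) = mx_of_tensor A *m mx_of_tensor B.
Proof.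
apply/matrixP => i k; rewrite !mxE ffunE /= big_enum_val.
by apply: eq_bigr => j _; rewrite !mxE.
Qed.

Lemma mx_of_ctrans M N (I : 'I_M -> nat) (J : 'I_N -> nat)
    (A : tensor R I J) :
  mx_of_tensor (ctrans A) = (mx_of_tensor A)^t*.
Proof. by apply/matrixP => i j; rewrite !mxE ffunE. Qed.

Lemma idtE N (J : 'I_N -> nat) (i j : midx J) : idt R J (i, j) = (i == j)%:R.
Proof.
rewrite ffunE /=; case: eqP => [->|ij].
  by rewrite big1 // => k _; rewrite eqxx.
have /existsP [k /negbTE ijk] : [exists k, i k != j k].
  by apply: contra_notT ij => /existsPn ij; apply/ffunP => k;
     apply/eqP; move: (ij k); rewrite negbK.
by rewrite (bigD1 k) //= ijk mul0r.
Qed.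

Lemma mx_of_idt N (J : 'I_N -> nat) : mx_of_tensor (idt R J) = 1%:M.
Proof.
by apply/matrixP => i j; rewrite !mxE idtE (inj_eq enum_val_inj).
Qed.

Lemma mx_of_tensor_inj M N (I : 'I_M -> nat) (J : 'I_N -> nat) :
  injective (@mx_of_tensor M N I J).
Proof. exact: can_inj (@mx_of_tensorK M N I J). Qed.

Lemma einsteinA M N L T (I : 'I_M -> nat) (J : 'I_N -> nat)
    (K : 'I_L -> nat) (H : 'I_T -> nat)
    (A : tensor R I J) (B : tensor R J K) (D : tensor R K H) :
  A *e (B *e D) = A *e B *e D.
Proof. by apply: mx_of_tensor_inj; rewrite !mx_of_einstein mulmxA. Qed.

Lemma ctransM M N L (I : 'I_M -> nat) (J : 'I_N -> nat) (K : 'I_L -> nat)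
    (A : tensor R I J) (B : tensor R J K) :
  ctrans (A *e B) = ctrans B *e ctrans A.
Proof.
by apply: mx_of_tensor_inj; rewrite !(mx_of_einstein, mx_of_ctrans) adjmxM.
Qed.

Lemma idtM M N (I : 'I_M -> nat) (J : 'I_N -> nat) (A : tensor R I J) :
  idt R I *e A = A.
Proof.
by apply: mx_of_tensor_inj; rewrite mx_of_einstein mx_of_idt mul1mx.
Qed.

Lemma idtMr M N (I : 'I_M -> nat) (J : 'I_N -> nat) (A : tensor R I J) :
  A *e idt R J = A.
Proof.
by apply: mx_of_tensor_inj; rewrite mx_of_einstein mx_of_idt mulmx1.
Qed.

Lemma ctrans_idt N (J : 'I_N -> nat) : ctrans (idt R J) = idt R J.
Proof.
by apply/ffunP => -[i j]; rewrite ffunE /= !idtE eq_sym conjC_nat.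
Qed.

Lemma hermitian_posdef_idt N (J : 'I_N -> nat) : hermitian_posdef (idt R J).
Proof.
exists (idt R J), (idt R J); rewrite /unitary ctrans_idt !idtM; split=> //.
- by move=> i j /eqP /negbTE ij; rewrite idtE ij.
- by move=> j; rewrite idtE eqxx ltr01.
Qed.

(** The form of [P] at [v] is that of [D] at [v Z], and [Z] is invertible; [P] is Hermitian because
    the diagonal entries of [D] are real. *)
Lemma hermitian_posdef_definite N (J : 'I_N -> nat) (P : tensor R J J) :
  hermitian_posdef P -> definite (mx_of_tensor P).
Proof.
case=> Z [D [[ZZ _] diagD posD ->]].
have {}ZZ := congr1 (@mx_of_tensor _ _ _ _) ZZ.
rewrite !(mx_of_einstein, mx_of_ctrans) mx_of_idt in ZZ *.
have diag (i j : 'I_#|midx J|) : i <> j -> mx_of_tensor D i j = 0.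
  by move=> ij; rewrite mxE diagD // => /enum_val_inj.
have pos (i : 'I_#|midx J|) : 0 < mx_of_tensor D i i by rewrite mxE posD.
split.
  rewrite !adjmxM trmxCK mulmxA; congr (_ *m _ *m _).
  apply/matrixP => i j; rewrite !mxE.
  have [->|/eqP ij] := eqVneq i j.
    by rewrite conj_Creal // gtr0_real.
  by rewrite !diagD ?conjC0 // => /enum_val_inj // /esym.
move=> v v0; suff vZ0 : v *m mx_of_tensor Z = 0.
  by rewrite -[v]mulmx1 -ZZ mulmxA vZ0 mul0mx.
by apply: (definite_diag diag pos); rewrite adjmxM !mulmxA in v0 *.
Qed.

Lemma hermitian_posdef_unit N (J : 'I_N -> nat) (P : tensor R J J) :
  hermitian_posdef P ->
  ctrans P = P /\
  exists P' : tensor R J J, P *e P' = idt R J /\ P' *e P = idt R J.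
Proof.
move=> /hermitian_posdef_definite dP; have uP := definite_unit dP; split.
  by apply: mx_of_tensor_inj; rewrite mx_of_ctrans (proj1 dP).
exists (tensor_of_mx (invmx (mx_of_tensor P))).
split; apply: mx_of_tensor_inj;
  by rewrite mx_of_einstein tensor_of_mxK mx_of_idt ?mulmxV ?mulVmx.
Qed.

(** * Existence and uniqueness of the weighted inverse of a tensor *)

Lemma is_wmpinv_exists M N (I : 'I_M -> nat) (J : 'I_N -> nat)
    (P : tensor R I I) (Q : tensor R J J) (A : tensor R I J) :
  hermitian_posdef P -> hermitian_posdef Q ->
  exists Y, is_wmpinv P Q A Y.
Proof.
move=> /hermitian_posdef_definite dP /hermitian_posdef_definite dQ.
have [Y [Y1 Y2 Y3 Y4]] := mx_wmpinv_exists (mx_of_tensor A) dP dQ.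
exists (tensor_of_mx Y); split; apply: mx_of_tensor_inj;
  by rewrite !(mx_of_einstein, mx_of_ctrans, tensor_of_mxK).
Qed.

Lemma wmpinvP M N (I : 'I_M -> nat) (J : 'I_N -> nat)
    (P : tensor R I I) (Q : tensor R J J) (A : tensor R I J) :
  hermitian_posdef P -> hermitian_posdef Q ->
  is_wmpinv P Q A (wmpinv P Q A).
Proof. by move=> hP hQ; exact: xgetPex (is_wmpinv_exists A hP hQ). Qed.

(** Since [A Z A = A], [P A Y = (P A Z) P^-1 (P A Y)]. Conjugate transposition reverses the right
    side to [P A Y A Z = P A Z], so [A Y = A Z]. Symmetrically [Y A = Z A], and then
    [Y = Y A Y = Z A Y = Z A Z = Z]. *)
Lemma is_wmpinv_unique M N (I : 'I_M -> nat) (J : 'I_N -> nat)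
    (P : tensor R I I) (Q : tensor R J J) (A : tensor R I J)
    (Y Z : tensor R J I) :
  hermitian_posdef P -> hermitian_posdef Q ->
  is_wmpinv P Q A Y -> is_wmpinv P Q A Z -> Y = Z.
Proof.
move=> /hermitian_posdef_unit [herP [P' [PP' P'P]]].
move=> /hermitian_posdef_unit [herQ [Q' [QQ' Q'Q]]].
move=> [Y1 Y2 Y3 Y4] [Z1 Z2 Z3 Z4].
have AYZ : A *e Y = A *e Z.
  rewrite -(idtM (A *e Y)) -(idtM (A *e Z)) -P'P -!einsteinA; congr (_ *e _).
  have defPAY : P *e A *e Y = P *e A *e Z *e P' *e (P *e A *e Y).
    by rewrite !einsteinA -(einsteinA _ P') P'P idtMr -(einsteinA P A Z)
               -(einsteinA P _ A) Z1.
  rewrite !einsteinA -Y3 defPAY ctransM (ctransM _ P') Y3 Z3.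
  have herP' : ctrans P' = P'.
    by rewrite -(idtM (ctrans P')) -P'P -{1}herP -einsteinA -ctransM P'P
               ctrans_idt idtMr.
  rewrite herP' !einsteinA -(einsteinA _ P') P'P idtMr.
  by rewrite -(einsteinA P A Y) -(einsteinA P _ A) Y1.
have YZA : Y *e A = Z *e A.
  rewrite -(idtM (Y *e A)) -(idtM (Z *e A)) -Q'Q -!einsteinA; congr (_ *e _).
  have defQYA : Q *e Y *e A = Q *e Y *e A *e Q' *e (Q *e Z *e A).
    by rewrite !einsteinA -(einsteinA _ Q') Q'Q idtMr -(einsteinA _ A Z)
               -(einsteinA _ (A *e Z)) Z1.
  rewrite !einsteinA -Y4 defQYA ctransM (ctransM _ Q') Y4 Z4.
  have herQ' : ctrans Q' = Q'.
    by rewrite -(idtM (ctrans Q')) -Q'Q -{1}herQ -einsteinA -ctransM Q'Q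
               ctrans_idt idtMr.
  rewrite herQ' !einsteinA -(einsteinA _ Q') Q'Q idtMr.
  by rewrite -(einsteinA _ A Y) -(einsteinA _ (A *e Y)) Y1.
by rewrite -Y2 -Z2 YZA -!einsteinA AYZ.
Qed.

Lemma wmpinvE M N (I : 'I_M -> nat) (J : 'I_N -> nat)
    (P : tensor R I I) (Q : tensor R J J) (A : tensor R I J)
    (Y : tensor R J I) :
  hermitian_posdef P -> hermitian_posdef Q ->
  is_wmpinv P Q A Y -> wmpinv P Q A = Y.
Proof.
by move=> hP hQ; apply: is_wmpinv_unique => //; apply: wmpinvP.
Qed.

Lemma mpinvP M N (I : 'I_M -> nat) (J : 'I_N -> nat) (A : tensor R I J)
    (Y := mpinv A) :
  [/\ A *e Y *e A = A, Y *e A *e Y = Y, ctrans (A *e Y) = A *e Y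
    & ctrans (Y *e A) = Y *e A].
Proof.
have [] := wmpinvP A (hermitian_posdef_idt I) (hermitian_posdef_idt J).
by rewrite !idtM.
Qed.

(** * The weighted inverse of a product of three tensors *)

Lemma wmpinv_three_factors M N L T (I : 'I_M -> nat) (J : 'I_N -> nat)
    (K : 'I_L -> nat) (H : 'I_T -> nat)
    (wM : tensor R I I) (wN : tensor R H H)
    (U : tensor R I J) (B : tensor R J K) (W : tensor R K H) :
  hermitian_posdef wM -> hermitian_posdef wN ->
  let A := U *e B *e W in
  wmpinv wM wN A =
    wmpinv (idt R J) wN (mpinv U *e A) *e B
      *e wmpinv wM (idt R K) (A *e mpinv W).
Proof.
move=> hM hN A.
have [U1 U2 U3 U4] := mpinvP U; have [W1 W2 W3 W4] := mpinvP W.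
set Ud := mpinv U in U1 U2 U3 U4 *; set Wd := mpinv W in W1 W2 W3 W4 *.
have [] := wmpinvP (Ud *e A) (hermitian_posdef_idt J) hN.
set X := Ud *e A; set S := wmpinv _ _ X; rewrite idtM => X1 X2 X3 X4.
have [] := wmpinvP (A *e Wd) hM (hermitian_posdef_idt K).
set Y := A *e Wd; set Tt := wmpinv _ _ Y; rewrite idtM => Y1 Y2 Y3 Y4.
(* [G] is the middle factor [B] compressed by the projectors [Ud *e U] and [W *e Wd], as [PBQ]
   records. *)
pose G := X *e Wd.
have UX : U *e X = A by rewrite /X /A !einsteinA U1.
have YW : Y *e W = A by rewrite /Y /A -!einsteinA (einsteinA W) W1.
have GW : G *e W = X by rewrite /G /X /A -!einsteinA (einsteinA W) W1.
have UG : U *e G = Y by rewrite /G einsteinA UX.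
have GE : G = Ud *e Y by rewrite /G /X /Y einsteinA.
have PX : Ud *e U *e X = X by rewrite /X einsteinA U2.
have YQ : Y *e W *e Wd = Y by rewrite /Y -!einsteinA (einsteinA Wd) W2.
have EG : X *e S *e G = G by rewrite /G einsteinA X1.
have PBQ : Ud *e U *e B *e (W *e Wd) = G by rewrite /G /X /A !einsteinA.
clearbody G S Tt X Y Ud Wd A.
(* [PX] gives absorption on the left; both factors are Hermitian, so conjugate transposition moves
   it to the right. *)
have EP : X *e S *e (Ud *e U) = X *e S.
  by rewrite -X3 -U4 -ctransM einsteinA PX.
have QF : W *e Wd *e (Tt *e Y) = Tt *e Y.
  by rewrite -Y4 -W3 -ctransM -einsteinA (einsteinA Y) YQ.
have GF : G *e Tt *e Y = G by rewrite GE -!einsteinA (einsteinA Y) Y1.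
(* Expanding [S = S X S] and [Tt = Tt Y Tt] puts [X S] and [Tt Y] next to [B]; these absorb the two
   projectors, which turn [B] into [G]. *)
have SBT : S *e B *e Tt = S *e G *e Tt.
  transitivity (S *e (X *e S) *e B *e (Tt *e Y *e Tt)).
    by rewrite Y2 einsteinA X2.
  rewrite -QF -EP -!einsteinA; congr (S *e _).
  rewrite (einsteinA X) -[RHS]/(G *e Tt) -EG -!einsteinA.
  rewrite -PBQ.
  by rewrite -!einsteinA (einsteinA Tt) Y2.
rewrite SBT; apply: wmpinvE => //.
have ZA : S *e G *e Tt *e A = S *e X.
  by rewrite -YW -!einsteinA (einsteinA Tt) (einsteinA G) (einsteinA G) GF GW.
have AZ : A *e (S *e G *e Tt) = Y *e Tt.
  by rewrite -UX !einsteinA -(einsteinA U) -(einsteinA U) EG UG.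
(* With [A Z = Y Tt] and [Z A = S X] for [Z = S G Tt], the first and third equations come from those
   of [Y], the second and fourth from those of [X]. *)
split.
- by rewrite AZ -YW einsteinA Y1.
- by rewrite ZA !einsteinA X2.
- by rewrite -einsteinA AZ einsteinA.
- by rewrite -einsteinA ZA einsteinA.
Qed.

End TensorMatrix.

Theorem theorem6 (R : realType) (M N L T : nat)
    (I : 'I_M -> nat) (J : 'I_N -> nat) (K : 'I_L -> nat) (H : 'I_T -> nat)
    (U : tensor R I J) (V : tensor R J K) (W : tensor R K H)
    (wM : tensor R I I) (wN : tensor R H H)
    (hM : hermitian_posdef wM) (hN : hermitian_posdef wN) :
  let A := U *e V *e W in
  (let X := mpinv (U *e V *e mpinv V) *e A in
   let Y := A *e mpinv (mpinv V *e V *e W) in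
   wmpinv wM wN A = wmpinv (idt R J) wN X *e V *e wmpinv wM (idt R K) Y)
  /\
  (let X := mpinv (U *e ctrans (mpinv V)) *e A in
   let Y := A *e mpinv (ctrans (mpinv V) *e W) in
   wmpinv wM wN A =
     wmpinv (idt R K) wN X *e ctrans V *e V *e ctrans V
       *e wmpinv wM (idt R J) Y).
Proof.
move=> A; have [V1 V2 V3 V4] := mpinvP V; split=> X Y.
(* Regrouping of [V = V V^dag V V^dag V] around its middle [V]. *)
- have AE : A = U *e V *e mpinv V *e V *e (mpinv V *e V *e W).
    by rewrite /A !einsteinA -!(einsteinA U) !V1.
  by rewrite /X /Y AE; apply: wmpinv_three_factors.
- pose B := ctrans V *e V *e ctrans V.
  (* Here [ctrans (mpinv V) *e ctrans V] is the conjugate transpose of the Hermitian [V V^dag], and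
     the reversed product that of [V^dag V]; the inner product is again [V V^dag V V^dag V]. *)
  have AE : A = U *e ctrans (mpinv V) *e B *e (ctrans (mpinv V) *e W).
    rewrite /A /B !einsteinA -(einsteinA U (ctrans _)) -ctransM V3.
    rewrite -(einsteinA _ (ctrans V)) -ctransM V4.
    by rewrite !einsteinA -!(einsteinA U) !V1.
  have -> : wmpinv (idt R K) wN X *e ctrans V *e V *e ctrans V
      = wmpinv (idt R K) wN X *e B by rewrite /B !einsteinA.
  by rewrite /X /Y AE; apply: wmpinv_three_factors.
Qed.
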